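(* Every Halin graph $G$ satisfies $\mathrm{fvs}(G) \leq 2\cdot \mathrm{cp}(G)$.
   Context: All graphs are finite and simple. A Halin graph is a planar graph constructed by connecting the leaves of a tree into a cycle; that is, $G$ is planar and there are a tree $T$ and a cycle $C$ whose vertex set is exactly the set of leaves of $T$, such that $V(G)=V(T)$ and $E(G)=E(T)\cup E(C)$. (Vertices of degree $2$ in $T$ are not excluded.) A cycle packing of a graph $G$ is a set of pairwise vertex-disjoint cycles that appear in $G$ as subgraphs; $\mathrm{cp}(G)$ denotes the maximum size (number of cycles) of a cycle packing of $G$. A feedback vertex set of $G$ is a set $S$ of vertices of $G$ such that $G\setminus S$ (the graph obtained by deleting the vertices of $S$) is a forest; $\mathrm{fvs}(G)$ denotes the minimum size of a feedback vertex set of $G$. *)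

(* Defs.v *)
From mathcomp Require Import all_boot all_order all_algebra.
From mathcomp Require Import all_classical all_reals all_analysis.
Import numFieldNormedType.Exports.

Set Implicit Arguments.
Unset Strict Implicit.
Unset Printing Implicit Defensive.

Record sgraph (V : finType) := SGraph {
  adj :> V -> V -> bool;
  adj_sym : symmetric adj;
  adj_irr : irreflexive adj }.

Section Graphs.
Variable V : finType.
Implicit Types (G T : sgraph V) (A S : {set V}) (c : seq V).

(* The cyclic sequence of the vertices of a cycle that is a subgraph of G. *)
Definition is_cycle G c := (2 < size c) && ucycleb G c.

(* The edges of the cycle with cyclic vertex sequence c.  The test x \in c is
   needed because next and prev fix the elements outside c. *)
Definition cycle_edge c x y := (x \in c) && ((y == next c x) || (y == prev c x)).

Definition forest G : Prop := forall c, ~~ is_cycle G c.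

Definition tree G : Prop :=
  [/\ 0 < #|V|, forall x y, connect G x y & forest G].

Definition leaf G x := #|[set y | G x y]| == 1.

(* A cycle packing, each cycle being recorded by its vertex set: vertex-disjoint
   cycles have distinct vertex sets, so #|P| is the number of cycles. *)
Definition cycle_packing G (P : {set {set V}}) : Prop :=
  finset.trivIset P /\
  forall A, A \in P -> exists2 c, is_cycle G c & A = [set x in c].

Definition cp G := \max_(P : {set {set V}} | `[< cycle_packing G P >]) #|P|.

Definition induced_adj G A : rel {x : V | x \in A} :=
  fun x y => G (val x) (val y).

Fact induced_sym G A : symmetric (@induced_adj G A).
Proof. by move=> x y; apply: adj_sym. Qed.

Fact induced_irr G A : irreflexive (@induced_adj G A).
Proof. by move=> x; apply: adj_irr. Qed.

Definition induced_subgraph G A : sgraph {x : V | x \in A} :=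
  SGraph (@induced_sym G A) (@induced_irr G A).

End Graphs.

Definition feedback_vertex_set (V : finType) (G : sgraph V) (S : {set V}) : Prop :=
  forest (induced_subgraph G (~: S)).

Definition fvs (V : finType) (G : sgraph V) : nat :=
  #|[arg min_(S < finset.setT | `[< feedback_vertex_set G S >]) #|S|]|.

Section Planarity.
Local Open Scope ring_scope.
Local Open Scope classical_set_scope.
Variable R : realType.

Definition is_arc (A : set (R * R)) (p q : R * R) : Prop :=
  exists f : R -> R * R,
    [/\ {within `[0, 1], continuous f}, {in `[0, 1] &, injective f},
        f 0 = p, f 1 = q & f @` `[0, 1] = A].

(* (pos, arc) is a drawing of G in the plane without crossings: an arc meets the
   set of vertices only at its ends, and two distinct edges (two distinct
   unordered pairs of ends) meet only at vertices, hence at common ends. *)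
Definition plane_drawing (V : finType) (G : sgraph V)
    (pos : V -> R * R) (arc : V -> V -> set (R * R)) : Prop :=
  [/\ injective pos,
      forall x y, arc x y = arc y x,
      forall x y, G x y -> is_arc (arc x y) (pos x) (pos y),
      forall x y z, G x y -> arc x y (pos z) -> z = x \/ z = y
    & forall x y z t, G x y -> G z t ->
        [set x; y]%SET <> [set z; t]%SET -> arc x y `&` arc z t `<=` range pos].

Definition planar (V : finType) (G : sgraph V) : Prop :=
  exists pos arc, @plane_drawing V G pos arc.

Definition halin (V : finType) (G : sgraph V) : Prop :=
  planar G /\
  exists (T : sgraph V) (c : seq V),
    [/\ tree T,
        uniq c /\ (2 < size c)%N,
        forall x, (x \in c) = leaf T x
      & forall x y, G x y = T x y || cycle_edge c x y].

End Planarity.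

Section Checks.
Variables (V : finType) (G : sgraph V).

Lemma cp_attained : exists2 P, cycle_packing G P & #|P| = cp G.
Proof.
rewrite /cp; elim/big_ind: _.
- exists finset.set0; last exact: cards0.
  by split=> [|A]; [apply/finset.trivIsetP=> A B | ]; rewrite finset.inE.
- by move=> m n hm hn; rewrite /maxn; case: ifP.
- by move=> P /asboolP hP; exists P.
Qed.

Lemma cp_max P : cycle_packing G P -> #|P| <= cp G.
Proof.
by move=> /asboolP hP; rewrite /cp (bigD1 P) //= leq_maxl.
Qed.

Lemma feedback_vertex_setT : feedback_vertex_set G finset.setT.
Proof. by case=> // -[x hx]; exfalso; move: hx; rewrite !finset.inE. Qed.

Lemma fvsP : (exists2 S, feedback_vertex_set G S & #|S| = fvs G) /\
  (forall S, feedback_vertex_set G S -> fvs G <= #|S|).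
Proof.
rewrite /fvs; case: arg_minnP => [|S /asboolP hS minS].
  exact/asboolP/feedback_vertex_setT.
by split=> [|A /asboolP]; [exists S | apply: minS].
Qed.

End Checks.

(* Main.v *)
Require Import Defs.
From mathcomp Require Import all_boot all_order all_algebra.
From mathcomp Require Import all_classical all_reals all_analysis.
From mathcomp Require Import ring lra zify.

(** Root the tree T at a leaf r, so that the outer cycle C visits the other
    leaves in a linear order. Planarity enters only through one consequence:
    the leaves below a vertex v other than r are consecutive in this order
    ([leaves_contiguous]). Hence at most two edges of C leave the subtree of v,
    one at its first leaf and one at its last.

    A packing and a feedback vertex set are then built together, greedily. If a
    set A of vertices carries a cycle, take v as deep as possible such that the
    vertices of A below v still carry one. Every cycle among these passes
    through v ([acyclic_below]), and once v and the first leaf below v are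
    deleted, no cycle of A enters the subtree of v any more, since only one edge
    leads into it ([acyclic_cut]). Two vertices have been spent for one cycle,
    which lies in the subtree of v; the construction goes on with the vertices
    of A outside this subtree ([packing_transversal]).

    If the leaves below v were not consecutive, T and C would contain a
    subdivision of K_{3,3}. That K_{3,3} has no plane drawing is proved by a
    parity argument. Arcs of disjoint edges are at a positive distance from each
    other, so the arcs can be replaced by polygonal lines such that the lines of
    disjoint edges are disjoint ([planar_crossings]). For disjoint lines e and
    f, the map sending p on e and q on f to p - q avoids the origin, so that it
    winds evenly around it along the boundary of the rectangle e x f; this gives
    a linear relation modulo 2 between the crossings of e with vertical rays
    from the ends of f and vice versa ([crossings_disjoint]). For two disjoint
    claws with the same three ends, the relations add up to the statement that a
    certain parity distinguishes them, and no three claws can be distinguished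
    pairwise by a parity ([no_K33]). *)

Set Implicit Arguments.
Unset Strict Implicit.
Unset Printing Implicit Defensive.
Import Order.TTheory GRing.Theory Num.Theory.
Import numFieldNormedType.Exports.

(** * Crossing parities of polygonal lines *)

Fixpoint chain (T : Type) (E : T -> T -> Prop) (x : T) (s : seq T) : Prop :=
  if s is y :: s' then E x y /\ chain E y s' else True.

Section Crossings.
Local Open Scope ring_scope.
Variable R : realFieldType.
Implicit Types (u w p q z : R * R) (s t : seq (R * R)).
Implicit Types (E : R * R -> R * R -> Prop).

(** The side of the vertical axis on which w lies, the axis itself being cut at
    the origin: its lower half goes to the left side, its upper half to the
    right one. Every nonzero w is then on the side opposite to - w, even when it
    lies on the axis. *)
Definition lexneg w := (w.1 < 0) || ((w.1 == 0) && (w.2 < 0)).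

Definition det u w := u.1 * w.2 - u.2 * w.1.

(** Does the segment from u to w cross the vertical ray going up from 0? *)
Definition ray_cross u w :=
  (lexneg u && ~~ lexneg w && (det u w < 0))
  || (lexneg w && ~~ lexneg u && (0 < det u w)).

Definition segpt p q (a : R) : R * R :=
  (p.1 + a * (q.1 - p.1), p.2 + a * (q.2 - p.2)).

Definition segments_meet p p' q q' := exists a b : R,
  [/\ 0 <= a <= 1, 0 <= b <= 1 & segpt p p' a = segpt q q' b].

Lemma lexnegN w : w <> 0 -> lexneg (- w) = ~~ lexneg w.
Proof.
case: w => a b /= ab0; rewrite /lexneg /= oppr_lt0 oppr_eq0 oppr_lt0.
case: (ltgtP a 0) => //= a0; case: (ltgtP b 0) => //= b0.
by case: ab0; rewrite a0 b0.
Qed.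

(** A segment from a negative to a nonnegative vector meets the vertical axis,
    above, at or below the origin according to the sign of [det u w]. When the
    segment lies on the axis, its lower end is the point recorded. *)
Lemma axis_point u w : lexneg u -> ~~ lexneg w -> exists a : R,
  [/\ 0 <= a <= 1, (segpt u w a).1 = 0,
      det u w < 0 -> 0 < (segpt u w a).2
    & 0 <= det u w -> (segpt u w a).2 <= 0].
Proof.
case: u w => [x y] [x' y']; rewrite /lexneg /det /= => nu nw.
have [xx' | xx'] := ltP x x'.
  have x0 : x <= 0 by case/orP: nu => [|/andP[/eqP]]; lra.
  have x0' : 0 <= x' by move: nw; rewrite negb_or -leNgt; case/andP.
  have height : y + - x / (x' - x) * (y' - y) = - (x * y' - y * x') / (x' - x).
    by field; lra.
  exists (- x / (x' - x)); split=> /=.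
  - by rewrite divr_ge0 ?ler_pdivrMr //; lra.
  - by field; lra.
  - by rewrite height => d; rewrite divr_gt0 //; lra.
  - by rewrite height => d; rewrite mulNr oppr_le0 divr_ge0 //; lra.
have [x0 [x'0 [y0 y'0]]] : x = 0 /\ x' = 0 /\ y < 0 /\ 0 <= y'.
  by case/orP: nu => [|/andP[/eqP]]; move: nw; rewrite negb_or -leNgt;
    case/andP=> ?; rewrite negb_and -leNgt => /orP[/eqP|]; lra.
by subst x x'; exists 0; split=> //=; lra.
Qed.

Lemma det0_origin u w : lexneg u -> ~~ lexneg w -> det u w = 0 ->
  exists2 a : R, 0 <= a <= 1 & segpt u w a = 0.
Proof.
case: u w => [x y] [x' y']; rewrite /lexneg /det /= => nu nw d0.
have [xx' | xx'] := ltP x x'.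
  have x0 : x <= 0 by case/orP: nu => [|/andP[/eqP]]; lra.
  have x0' : 0 <= x' by move: nw; rewrite negb_or -leNgt; case/andP.
  exists (- x / (x' - x)); first by rewrite divr_ge0 ?ler_pdivrMr //; lra.
  rewrite /segpt /=; congr pair; first by field; lra.
  have -> : y + - x / (x' - x) * (y' - y) = - (x * y' - y * x') / (x' - x).
    by field; lra.
  by rewrite d0 oppr0 mul0r.
have [x0 [x'0 [y0 y'0]]] : x = 0 /\ x' = 0 /\ y < 0 /\ 0 <= y'.
  by case/orP: nu => [|/andP[/eqP]]; move: nw; rewrite negb_or -leNgt;
    case/andP=> ?; rewrite negb_and -leNgt => /orP[/eqP|]; lra.
subst x x'; exists (- y / (y' - y)).
  by rewrite divr_ge0 ?ler_pdivrMr //; lra.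
rewrite /segpt /=; congr pair; first by ring.
by field; lra.
Qed.

(** Reflecting the segment through the origin amounts to counting crossings
    with the downward ray; the two rays together make up the axis, which the
    segment crosses when its ends are on different sides. *)
Lemma ray_cross_opp u w : (forall a : R, 0 <= a <= 1 -> segpt u w a <> 0) ->
  ray_cross (- u) (- w) = ray_cross u w (+) lexneg u (+) lexneg w.
Proof.
move=> uw0.
have u0 : u <> 0.
  by move=> u0; apply: (uw0 0); rewrite ?lexx ?ler01 // u0 /segpt /= !mul0r addr0.
have w0 : w <> 0.
  move=> w0; apply: (uw0 1); rewrite ?lexx ?ler01 // w0 /segpt /= !mul1r.
  by rewrite !add0r !subrr.
have dN : det (- u) (- w) = det u w by rewrite /det /=; ring.
rewrite /ray_cross dN !lexnegN //.
have aux v v' : lexneg v -> ~~ lexneg v' ->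
  (forall a : R, 0 <= a <= 1 -> segpt v v' a <> 0) -> det v v' != 0.
  move=> nv nv' h; apply/eqP => d0.
  by have [b b01 /(h _ b01)] := det0_origin nv nv' d0.
case nu: (lexneg u); case nw: (lexneg w) => //=.
- by have /eqP := aux _ _ nu (negbT nw) uw0; case: (ltgtP (det u w) 0).
- have /eqP : det w u != 0.
    apply: aux => //; first exact: negbT.
    move=> a a01 h; apply: (uw0 (1 - a)); first by lra.
    by rewrite -h /segpt; congr pair => /=; ring.
  have -> : det w u = - det u w by rewrite /det; ring.
  by case: (ltgtP (det u w) 0) => // ->; rewrite oppr0.
Qed.

(** The difference of a point of the first segment and a point of the second
    describes a parallelogram avoiding the origin, whose boundary therefore
    winds around the origin an even number of times. Concretely, the
    parallelogram is convex, so the points where it meets the vertical axis are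
    all above or all below the origin; in the first case the sides that cross
    the upward ray are the sides that cross the axis, and they are even in
    number, in the second case no side crosses the ray. *)
Lemma square_crossings p p' q q' : ~ segments_meet p p' q q' ->
  ray_cross (p - q) (p' - q) (+) ray_cross (p - q') (p' - q')
  (+) ray_cross (p - q) (p - q') (+) ray_cross (p' - q) (p' - q') = false.
Proof.
move=> nmeet.
pose W (a b : R) : R * R := segpt p p' a - segpt q q' b.
have pt0 x y : segpt x y 0 = x :> R * R.
  by case: x => *; rewrite /segpt /= !mul0r !addr0.
have pt1 x y : segpt x y 1 = y :> R * R.
  by case: x => *; case: y => *; rewrite /segpt /=; congr pair; ring.
pose up := `[< exists a b : R, [/\ 0 <= a <= 1, 0 <= b <= 1, (W a b).1 = 0
                             & 0 < (W a b).2] >].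
have upP (a b : R) : 0 <= a <= 1 -> 0 <= b <= 1 -> (W a b).1 = 0 ->
    (W a b).2 <= 0 -> ~~ up.
  (* Otherwise the origin is a convex combination, of weight l, of a point of
     the axis above it and a point below. *)
  move=> a01 b01 w1 w2; apply/asboolPn => -[a' [b' [a01' b01' w1' w2']]].
  apply: nmeet; pose l : R := - (W a b).2 / ((W a' b').2 - (W a b).2).
  have l01 : 0 <= l <= 1 by rewrite divr_ge0 ?ler_pdivrMr //; lra.
  exists (a + l * (a' - a)), (b + l * (b' - b)); split.
  - nra.
  - nra.
  have lE : l * ((W a' b').2 - (W a b).2) = - (W a b).2 by rewrite divfK //; lra.
  move: lE w1 w1'; rewrite /W /segpt /= => lE w1 w1'.
  congr pair; nra.
have side n m : (forall a : R, 0 <= a <= 1 -> exists b c : R,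
     [/\ 0 <= b <= 1, 0 <= c <= 1 & segpt n m a = W b c]) ->
   lexneg n -> ~~ lexneg m -> up = (det n m < 0).
  move=> sq nn nm; have [a [a01 w1 above below]] := axis_point nn nm.
  have [b [c [b01 c01 E]]] := sq a a01; rewrite E in w1 above below.
  case: ltP => [/above | /below].
    by move=> w2; apply/asboolP; exists b, c.
  by move/(upP _ _ b01 c01 w1)/negbTE.
have crossE n m : (forall a : R, 0 <= a <= 1 -> exists b c : R,
     [/\ 0 <= b <= 1, 0 <= c <= 1 & segpt n m a = W b c]) ->
   ray_cross n m = up && (lexneg n (+) lexneg m).
  move=> sq; rewrite /ray_cross.
  case nn: (lexneg n); case nm: (lexneg m); rewrite ?andbF ?andbT //=.
    by rewrite orbF (side _ _ sq) // nm.
  rewrite (side m n) ?nn //; last first.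
    move=> a a01; have [|b [c [b01 c01 E]]] := sq (1 - a); first by lra.
    exists b, c; split=> //; rewrite -E /segpt /=; congr pair; ring.
  have -> : det m n = - det n m by rewrite /det; ring.
  by rewrite oppr_lt0.
have edge n m b c b' c' : n = W b c -> m = W b' c' ->
    0 <= b <= 1 -> 0 <= c <= 1 -> 0 <= b' <= 1 -> 0 <= c' <= 1 ->
  ray_cross n m = up && (lexneg n (+) lexneg m).
  move=> -> -> b01 c01 b01' c01'; apply: crossE => a a01.
  exists (b + a * (b' - b)), (c + a * (c' - c)); split; [nra | nra |].
  by rewrite /W /segpt /=; congr pair => /=; ring.
have h0 : 0 <= (0 : R) <= 1 by lra.
have h1 : 0 <= (1 : R) <= 1 by lra.
have [E00 E10 E01 E11] : [/\ p - q = W 0 0, p' - q = W 1 0, p - q' = W 0 1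
  & p' - q' = W 1 1] by rewrite /W !pt0 !pt1.
rewrite (edge _ _ _ _ _ _ E00 E10) // (edge _ _ _ _ _ _ E01 E11) //.
rewrite (edge _ _ _ _ _ _ E00 E01) // (edge _ _ _ _ _ _ E10 E11) //.
by do 4!case: (lexneg _); case: (up).
Qed.

(** Two adjacent rectangles of a product of polygonal lines share a side, whose
    contribution d cancels. *)
Lemma addb_glue (a b a' b' c d e : bool) : a (+) b (+) c (+) d = false ->
  a' (+) b' (+) d (+) e = false ->
  (a (+) a') (+) (b (+) b') (+) c (+) e = false.
Proof. by move: a b a' b' c d e; do 7!case. Qed.

Lemma addb_exchange (a b c d m n m' n' : bool) :
  a (+) b (+) (c (+) m (+) n) (+) (d (+) m' (+) n') =
  a (+) b (+) c (+) d (+) m (+) n (+) m' (+) n'.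
Proof. by move: a b c d m n m' n'; do 8!case. Qed.

Fixpoint ray_crossings z p s :=
  if s is q :: s' then ray_cross (p - z) (q - z) (+) ray_crossings z q s'
  else false.

Fixpoint ray_crossings_opp z p s :=
  if s is q :: s' then ray_cross (z - p) (z - q) (+) ray_crossings_opp z q s'
  else false.

Lemma crossings_oppE E z p s :
  (forall q q', E q q' -> ~ segments_meet z z q q') -> chain E p s ->
  ray_crossings_opp z p s
    = ray_crossings z p s (+) lexneg (p - z) (+) lexneg (last p s - z).
Proof.
move=> hE; elim: s p => [|q s IH] p /=; first by rewrite addbb.
case=> /hE pq /IH ->.
rewrite -(opprB p z) -(opprB q z) ray_cross_opp.
  by case: (ray_cross _ _); case: (ray_crossings _ _ _); do 3!case: (lexneg _).
move=> a a01 h; apply: pq; exists 0, a; split=> //; first by rewrite lexx ler01.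
move: (congr1 fst h) (congr1 snd h); rewrite /segpt /= => h1 h2.
by congr pair => /=; lra.
Qed.

Lemma crossings_opp_disjoint E E' p s q t :
  (forall x x' y y', E x x' -> E' y y' -> ~ segments_meet x x' y y') ->
  chain E p s -> chain E' q t ->
  ray_crossings q p s (+) ray_crossings (last q t) p s
  (+) ray_crossings_opp p q t (+) ray_crossings_opp (last p s) q t = false.
Proof.
move=> disj; elim: s p => [|p' s IHs] p /=; first by rewrite addbb.
case=> pp' ps qt; apply: addb_glue (IHs _ ps qt).
elim: t q qt {IHs ps} => [|q' t IHt] q /=; first by rewrite addbb.
case=> qq' /IHt; have := square_crossings (disj _ _ _ _ pp' qq').
move: (ray_cross _ _) (ray_cross _ _) (ray_cross _ _) (ray_cross _ _).
move: (ray_cross _ _).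
move: (ray_crossings_opp _ _ _) (ray_crossings_opp _ _ _).
by do 7!case.
Qed.

(** The relation on which the proof that K_{3,3} is not planar rests. It only
    involves the crossings of each line with the upward rays from the ends of
    the other one, and the left-right order of the four ends. *)
Lemma crossings_disjoint E E' p s q t :
  (forall x x' y y', E x x' -> E' y y' -> ~ segments_meet x x' y y') ->
  (forall y y', E' y y' -> ~ segments_meet p p y y') ->
  (forall y y', E' y y' -> ~ segments_meet (last p s) (last p s) y y') ->
  chain E p s -> chain E' q t ->
  ray_crossings q p s (+) ray_crossings (last q t) p s
  (+) ray_crossings p q t (+) ray_crossings (last p s) q t
  (+) lexneg (q - p) (+) lexneg (last q t - p)
  (+) lexneg (q - last p s) (+) lexneg (last q t - last p s) = false.
Proof.
move=> disj disjp disjl ps qt; have := crossings_opp_disjoint disj ps qt.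
by rewrite (crossings_oppE disjp qt) (crossings_oppE disjl qt) addb_exchange.
Qed.

End Crossings.

(** * Polygonal approximation of a plane drawing *)

Section Drawing.
Local Open Scope ring_scope.
Local Open Scope classical_set_scope.

Lemma compact_gap (R : realType) (T : pseudoMetricType R) (A B : set T) :
  compact A -> closed B -> A `&` B = set0 ->
  \forall e \near 0^'+, forall a b, A a -> B b -> ~ ball a e b.
Proof.
move=> /compact_near_coveringP cA clB AB0.
suff : \forall e \near 0^'+, A `<=` (fun a => forall b, B b -> ~ ball a e b).
  by apply: filterS => e h a b Aa; apply: h.
apply: cA => a Aa.
have /nbhs_ballP[e /= e0 eB] : nbhs a (~` B).
  by apply: open_nbhs_nbhs; split; [exact: closed_openC | move=> Ba;
    have : (A `&` B) a by []; rewrite AB0].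
exists (ball a (e / 2), [set d | d < e / 2]) => /=; last first.
  move=> [a' d] /= [aa' de] b Bb a'b; apply: eB Bb.
  apply: (le_ball (ltW _) (ball_triangle aa' a'b)); lra.
split; first by apply: nbhsx_ballx; lra.
by apply: nbhs_right_lt; lra.
Qed.

(** The points of A that can be reached from p by steps shorter than e form a
    subset that is both open and closed in A. *)
Lemma connected_chain (R : realType) (T : pseudoMetricType R) (A : set T)
    (p q : T) (e : R) : connected A -> A p -> A q -> 0 < e ->
  exists2 s, chain (fun x y => [/\ A x, A y & ball x e y]) p s & last p s = q.
Proof.
move=> cA Ap Aq e0.
pose E x y := [/\ A x, A y & ball x e y].
pose B := [set x | A x /\ exists2 s, chain E p s & last p s = x].
have Eball x y : B x -> E x y -> B y.
  case=> Ax [s ps <-] sy; split; first by case: sy.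
  exists (rcons s y); last exact: last_rcons.
  elim: s p ps sy {cA Ap B Ax} => //= z s IH p [pz zs] sy; split=> //.
  exact: IH.
suff BA : B = A by have [_ ] : B q by rewrite BA.
apply: cA.
- by exists p; split=> //; exists [::].
- exists (\bigcup_(x in B) (ball x e)^°).
    by apply: bigcup_open => x Bx; exact: open_interior.
  apply/seteqP; split=> [x Bx | x [Ax [y By /interior_subset yx]]].
    by split; [case: Bx | exists x => //; apply: nbhsx_ballx].
  by apply: (Eball y x By); split=> //; case: By.
exists (~` (\bigcup_(x in A `\` B) (ball x e)^°)).
  by apply: open_closedC; apply: bigcup_open => x Bx; exact: open_interior.
apply/seteqP; split=> [x Bx | x [Ax nx]].
  split; first by case: Bx.
  case=> y [Ay nBy] /interior_subset yx; apply: nBy; apply: (Eball x y Bx).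
  by split=> //; [case: Bx | exact: ball_sym].
by apply: contrapT => nBx; apply: nx; exists x => //; apply: nbhsx_ballx.
Qed.

Lemma arc_compact (R : realType) (A : set (R * R)) p q : is_arc A p q -> compact A.
Proof.
by case=> f [fc _ _ _ <-]; apply: continuous_compact fc (@segment_compact _ _ _).
Qed.

Lemma arc_closed (R : realType) (A : set (R * R)) p q : is_arc A p q -> closed A.
Proof. by move=> /arc_compact; apply: compact_closed; exact: norm_hausdorff. Qed.

Lemma arc_chain (R : realType) (A : set (R * R)) p q (e : R) :
  is_arc A p q -> 0 < e ->
  exists2 s, chain (fun x y => [/\ A x, A y & ball x e y]) p s & last p s = q.
Proof.
case=> f [fc _ f0 f1 fA]; apply: connected_chain.
- by rewrite -fA; apply: connected_continuous_connected fc; exact: segment_connected.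
- by rewrite -fA -f0; exists 0 => //=; rewrite in_itv /= lexx ler01.
- by rewrite -fA -f1; exists 1 => //=; rewrite in_itv /= lexx ler01.
Qed.

(** Both segments stay within e / 2 of their first ends. *)
Lemma near_no_meet (R : realType) (x x' y y' : R * R) (e : R) :
  0 < e -> ball x (e / 2) x' -> ball y (e / 2) y' -> ~ ball x e y ->
  ~ segments_meet x x' y y'.
Proof.
move=> e0 [/= xx1 xx2] [/= yy1 yy2] xy [a [b [a01 b01 [h1 h2]]]]; apply: xy.
have half (u : R) c : 0 <= c <= 1 -> `|u| < e / 2 -> `|c * u| < e / 2.
  move=> /andP[c0 c1]; apply: le_lt_trans.
  by rewrite normrM ger0_norm // ler_piMl.
have close (u u' v v' : R) : u + a * (u' - u) = v + b * (v' - v) ->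
    ball u (e / 2) u' -> ball v (e / 2) v' -> ball u e v.
  rewrite /ball /= => h uu vv.
  have -> : u - v = b * (v' - v) - a * (u' - u) by lra.
  rewrite (splitr e); apply: le_lt_trans (ler_normB _ _) _.
  by rewrite ltrD // half // distrC.
by split; [exact: close h1 _ _ | exact: close h2 _ _].
Qed.

(** What is retained of a drawing: [lt z x] tells whether z is to the left of x
    and [cr x y z] is the parity of the number of crossings of the edge xy with
    the upward ray from z. Each arc is replaced by a polygonal line with steps
    so short, compared to the least distance between arcs of disjoint edges,
    that the lines of disjoint edges are still disjoint. A line may cross
    itself, or lines of adjacent edges, which does no harm. *)
Lemma planar_crossings (R : realType) (V : finType) (G : sgraph V) :
  planar R G -> exists (lt : V -> V -> bool) (cr : V -> V -> V -> bool),
  (forall x y, x != y -> lt x y (+) lt y x) /\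
  (forall x y z t, G x y -> G z t -> x != z -> x != t -> y != z -> y != t ->
     cr x y z (+) cr x y t (+) cr z t x (+) cr z t y
     (+) lt z x (+) lt t x (+) lt z y (+) lt t y = false).
Proof.
case=> pos [arc [pos_inj _ arcP arcV arcE]].
pose apart (x y z t : V) := [&& x != z, x != t, y != z & y != t].
have disj x y z t : G x y -> G z t -> apart x y z t -> arc x y `&` arc z t = set0.
  move=> xy zt /and4P[xz xt yz yt]; rewrite -subset0 => w [wxy wzt].
  have [|u _ uw] := arcE _ _ _ _ xy zt _ w (conj wxy wzt).
    move=> /setP/(_ x); rewrite !finset.inE eqxx /= => /esym/orP[] /eqP;
    by [move/eqP: xz | move/eqP: xt].
  rewrite -uw in wxy wzt.
  case: (arcV _ _ _ xy wxy) (arcV _ _ _ zt wzt) => -> [] /eqP;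
  by rewrite ?(negPf xz) ?(negPf xt) ?(negPf yz) ?(negPf yt).
have : \forall e \near (0 : R)^'+, forall x y z t : V,
    G x y -> G z t -> apart x y z t ->
    forall p q, arc x y p -> arc z t q -> ~ ball p e q.
  do 4!apply: filter_forall => ?.
  case: (boolP (G _ _)) => [xy|_]; last by near=> e.
  case: (boolP (G _ _)) => [zt|_]; last by near=> e.
  case: (boolP (apart _ _ _ _)) => [a|_]; last by near=> e.
  have := compact_gap (arc_compact (arcP _ _ xy)) (arc_closed (arcP _ _ zt)).
  by move=> /(_ (disj _ _ _ _ xy zt a)); apply: filterS => e h _ _ _; exact: h.
move=> gap.
have [e [e0 {}gap]] : exists e : R, 0 < e /\ forall x y z t : V,
    G x y -> G z t -> apart x y z t ->
    forall p q, arc x y p -> arc z t q -> ~ ball p e q.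
  apply: (@filter_ex _ (0 : R)^'+).
  by apply: filterS2 gap (nbhs_right_gt 0) => e h e0; split.
pose E x y p q := [/\ arc x y p, arc x y q & ball p (e / 2) q].
pose good x y s := G x y ->
  chain (E x y) (pos x) s /\ last (pos x) s = pos y.
have [S SP] : {S : V -> V -> seq (R * R) &
    forall x, forall y, good x y (S x y)}.
  apply: (choice (P := fun x f => forall y, good x y (f y))) => x.
  suff [f fP] : {f : V -> seq (R * R) & forall y, good x y (f y)} by exists f.
  apply: (choice (P := good x)) => y; rewrite /good.
  have [xy|] := boolP (G x y); last by exists nil.
  have [|s] := arc_chain (arcP _ _ xy) (e := e / 2); first lra.
  by exists s.
exists (fun x y => lexneg (pos x - pos y)),
  (fun x y z => ray_crossings (pos z) (pos x) (S x y)); split.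
  move=> x y xy; rewrite -(opprB (pos x)) lexnegN; first by case: lexneg.
  by move/subr0_eq/pos_inj => /eqP; apply/negP.
move=> x y z t xy zt xz xt yz yt.
have [Sxy Lxy] := SP _ _ xy; have [Szt Lzt] := SP _ _ zt.
have a : apart x y z t by apply/and4P.
have arc0 u v : G u v -> arc u v (pos u) by move=> /arcP[f [_ _ <- _ <-]];
  exists 0 => //=; rewrite in_itv /= lexx ler01.
have arc1 u v : G u v -> arc u v (pos v) by move=> /arcP[f [_ _ _ <- <-]];
  exists 1 => //=; rewrite in_itv /= lexx ler01.
have e2 : 0 < e / 2 by lra.
have far p p' q q' : arc x y p -> ball p (e / 2) p' -> E z t q q' ->
    ~ segments_meet p p' q q'.
  move=> xyp pp' [ztq ztq' qq']; apply: near_no_meet pp' qq' _ => //.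
  exact: gap xyp ztq.
have := @crossings_disjoint _ (E x y) (E z t) (pos x) (S x y) (pos z) (S z t).
rewrite Lxy Lzt; apply=> //.
- by move=> p p' q q' [? ? ?]; exact: far.
- by move=> q q'; apply: far (ballxx _ e2); exact: arc0.
- by move=> q q'; apply: far (ballxx _ e2); exact: arc1.
Unshelve. all: by end_near.
Qed.

End Drawing.

(** * K_{3,3} is not planar *)

Variant three := One | Two | Three.

Definition inside (V : finType) (e : rel V) (D : {set V}) : rel V :=
  fun x y => [&& x \in D, y \in D & e x y].

Lemma inside_sym (V : finType) (G : sgraph V) D : symmetric (inside G D).
Proof. by move=> x y; rewrite /inside adj_sym andbCA. Qed.

Lemma inside_connectS (V : finType) (e : rel V) (D D' : {set V}) x y :
  D \subset D' -> connect (inside e D) x y -> connect (inside e D') x y.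
Proof.
move=> /fintype.subsetP DD'; apply: connect_sub => u w /and3P[uD wD uw].
by apply: connect1; rewrite /inside !DD'.
Qed.

Section Kuratowski.
Variables (V : finType) (G : sgraph V) (lt : V -> V -> bool).
Variable cr : V -> V -> V -> bool.
Hypothesis lt_tot : forall x y, x != y -> lt x y (+) lt y x.
Hypothesis cr_disjoint : forall x y z t, G x y -> G z t ->
  x != z -> x != t -> y != z -> y != t ->
  cr x y z (+) cr x y t (+) cr z t x (+) cr z t y
  (+) lt z x (+) lt t x (+) lt z y (+) lt t y = false.

Fixpoint path_cr x p z : bool :=
  if p is y :: p' then cr x y z (+) path_cr y p' z else false.

(** The relation between two disjoint edges passes to two disjoint paths: over
    all pairs of an edge of the first and an edge of the second, the terms that
    belong to an inner vertex of a path occur twice. *)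
Lemma path_cr_disjoint (D D' : {set V}) x p z q : [disjoint D & D'] ->
  path (inside G D) x p -> path (inside G D') z q ->
  path_cr x p z (+) path_cr x p (last z q)
  (+) (path_cr z q x (+) (lt z x (+) lt (last z q) x))
  (+) (path_cr z q (last x p) (+) (lt z (last x p) (+) lt (last z q) (last x p)))
    = false.
Proof.
move=> DD'; elim: p x => [|y p IHp] x /=; first by rewrite !addbb.
case/andP=> xy yp zq; apply: addb_glue (IHp _ yp zq).
have neq u v : u \in D -> v \in D' -> u != v.
  by move=> uD; apply: contraTneq => <-; rewrite (disjointFr DD').
case/and3P: xy => xD yD xy.
elim: q z zq {IHp} => [|t q IHq] z /=; first by rewrite !addbb.
case/andP=> /and3P[zD tD zt] tq.
pose d v := cr z t v (+) (lt z v (+) lt t v).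
pose d' v := path_cr t q v (+) (lt t v (+) lt (last t q) v).
have split_d v : cr z t v (+) path_cr t q v (+) (lt z v (+) lt (last t q) v)
    = d v (+) d' v.
  rewrite /d /d'; move: (cr z t v) (path_cr t q v) => c c'.
  by move: (lt z v) (lt t v) (lt (last t q) v) c c'; do 5!case.
rewrite !split_d.
have /= := IHq _ tq; rewrite -/(d' x) -/(d' y).
have : cr x y z (+) cr x y t (+) d x (+) d y = false.
  rewrite -[RHS](cr_disjoint xy zt (neq _ _ xD zD) (neq _ _ xD tD)
    (neq _ _ yD zD) (neq _ _ yD tD)) /d.
  move: (cr x y z (+) _) (cr z t x) (cr z t y) (lt z x) (lt t x) (lt z y) (lt t y).
  by do 7!case.
move: (d x) (d y) (d' x) (d' y) (cr x y z) (cr x y t) (cr x y (last t q)).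
by do 7!case.
Qed.

Variables (a b : three -> V) (D : three -> three -> {set V}).
Hypothesis leg : forall s t,
  [/\ a s \in D s t, b t \in D s t & connect (inside G (D s t)) (a s) (b t)].
Hypothesis leg_disjoint : forall s s' t t', s <> s' -> t <> t' ->
  [disjoint D s t & D s' t'].

(** The paths [D s t], for t = 1, 2, 3, form a claw with centre [a s] and ends
    b 1, b 2, b 3. Its spin is the sum over t <> t' of the crossings of its
    path to b t with the ray from b t'; it plays the part of the cyclic order in
    which the claw sees its ends. Adding up the relations between the paths
    [D s t] and [D s' t'] over all t <> t' shows that two claws have different
    spins: all other terms occur twice, except that for each of the three pairs
    {t, t'} the two comparisons of b t and b t' add up to 1. But three claws
    cannot have pairwise different spins modulo 2. *)
Lemma no_K33 : False.
Proof.
have [p pP] : {p : three -> three -> seq V & forall s, forall t,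
    path (inside G (D s t)) (a s) (p s t) /\ last (a s) (p s t) = b t}.
  pose good s t q := path (inside G (D s t)) (a s) q /\ last (a s) q = b t.
  apply: (choice (P := fun s f => forall t, good s t (f t))) => s.
  suff [f fP] : {f : three -> seq V & forall t, good s t (f t)} by exists f.
  apply: (choice (P := good s)) => t.
  by have [_ _ /connectP[q pq E]] := leg s t; exists q; rewrite /good -E.
have pathE u t : path (inside G (D u t)) (a u) (p u t) by have [] := pP u t.
have lastE u t : last (a u) (p u t) = b t by have [] := pP u t.
pose turn s t t' := path_cr (a s) (p s t) (b t').
pose pair s t t' := turn s t t' (+) turn s t' t.
pose spin s := pair s One Two (+) pair s Two Three (+) pair s Three One.
suff spin_neq s s' : s <> s' -> spin s (+) spin s' = true.
  have h12 : spin One (+) spin Two = true by apply: spin_neq.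
  have h23 : spin Two (+) spin Three = true by apply: spin_neq.
  have : spin One (+) spin Three = true by apply: spin_neq.
  by case: (spin One) (spin Two) (spin Three) h12 h23 => -[] [].
move=> ss'.
(* The terms that depend on one end b t only; each occurs in the two pairs that
   contain t, hence disappears from the total. *)
pose K t := path_cr (a s) (p s t) (a s') (+) lt (a s') (b t)
  (+) (path_cr (a s') (p s' t) (a s) (+) lt (b t) (a s)).
have pairE t t' : t <> t' ->
    pair s t t' (+) pair s' t t' (+) (K t (+) K t') = true.
  move=> tt'.
  have btt' : b t != b t'.
    have [_ bt _] := leg s t; have [_ bt' _] := leg s' t'.
    apply/eqP => E; rewrite E in bt.
    by have := disjointFr (leg_disjoint ss' tt') bt; rewrite bt'.
  have solve (c1 c2 c3 c4 k l l' n : bool) :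
      c1 (+) c2 (+) (c3 (+) (k (+) l)) (+) (c4 (+) (l' (+) n)) = false ->
      c2 (+) c4 = (c1 (+) l') (+) (c3 (+) l) (+) (k (+) n).
    by move: c1 c2 c3 c4 k l l' n; do 8!case.
  have := path_cr_disjoint (leg_disjoint ss' tt') (pathE _ _) (pathE _ _).
  have := path_cr_disjoint (leg_disjoint ss' (nesym tt')) (pathE _ _)
    (pathE _ _).
  rewrite !lastE => /solve e /solve e'.
  rewrite /pair (addbC (turn s' t t')) (addbACA (turn _ _ _)) /turn e' e /K.
  have := lt_tot btt'; move: (lt (b t) (b t')) (lt (b t') (b t)) => n n'.
  move: (path_cr (a s) (p s t) (a s') (+) _).
  move: (path_cr (a s) (p s t') (a s') (+) _).
  move: (path_cr (a s') _ (a s) (+) lt (b t) _).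
  move: (path_cr (a s') _ (a s) (+) lt (b t') _).
  by move: (lt (a s') _) n n'; do 7!case.
have h12 : One <> Two by [].
have h23 : Two <> Three by [].
have h31 : Three <> One by [].
move: (pairE _ _ h12) (pairE _ _ h23) (pairE _ _ h31); rewrite /spin.
move: (pair s _ _) (pair s' _ _) (pair s _ _) (pair s' _ _) (pair s _ _).
move: (pair s' _ _).
by move: (K One) (K Two) (K Three); do 9!case.
Qed.

End Kuratowski.

(** The sets D s t contain the vertices of the nine paths of a subdivision of
    K_{3,3}; paths that share an end may overlap. *)
Lemma planar_no_K33 (R : realType) (V : finType) (G : sgraph V)
    (a b : three -> V) (D : three -> three -> {set V}) :
  planar R G ->
  (forall s t, [/\ a s \in D s t, b t \in D s t
                 & connect (inside G (D s t)) (a s) (b t)]) ->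
  (forall s s' t t', s <> s' -> t <> t' -> [disjoint D s t & D s' t']) ->
  False.
Proof.
move=> /planar_crossings[lt [cr [lt_tot crP]]] leg disj.
exact: (no_K33 lt_tot crP leg disj).
Qed.

(** * A cycle crosses a cut at least twice *)

Lemma connect_crossing (V : finType) (e : rel V) (P : pred V) x y :
  connect e x y -> P x -> ~~ P y ->
  exists u w, [/\ connect e x u, e u w, P u & ~~ P w].
Proof.
case/connectP=> s; elim: s x => [|z s IH] x /=; first by move=> _ -> ->.
move=> /andP[xz zs] ly Px nPy.
have [Pz | nPz] := boolP (P z); last by exists x, z.
have [u [w [zu uw Pu nPw]]] := IH _ zs ly Pz nPy.
by exists u, w; split=> //; apply: connect_trans zu; exact: connect1.
Qed.

Section OneSide.
Variables (V : finType) (G : sgraph V).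

Lemma next_crossing (c : seq V) (P : pred V) x y : uniq c ->
  x \in c -> y \in c -> P x -> ~~ P y ->
  exists u, [/\ u \in c, P u & ~~ P (next c u)].
Proof.
move=> uc xc yc Px nPy; have xE := fconnect_cycle (cycle_next uc) xc.
have xy : fconnect (next c) x y by rewrite xE.
have [u [w [xu /eqP <- Pu nPw]]] := connect_crossing xy Px nPy.
by exists u; rewrite -xE.
Qed.

(** A cycle with vertices on both sides leaves B along one edge and comes back
    along another: if the two edges were the same, the cycle would go back and
    forth along it and have two vertices only. *)
Lemma cycle_one_side (c : seq V) (B : {set V}) : is_cycle G c ->
  (forall x y x' y', x \in c -> y \in c -> x' \in c -> y' \in c ->
     x \in B -> y \notin B -> x' \in B -> y' \notin B ->
     G x y -> G x' y' -> x = x' /\ y = y') ->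
  {subset c <= B} \/ {in c, forall x, x \notin B}.
Proof.
case/and3P=> c3 cc uc uniq_edge.
have [|/allPn[y yc yB]] := boolP (all [in B] c); first by move/allP; left.
have [/hasP[x xc xB] | /hasPn] := boolP (has [in B] c); last by right.
have [u [uc' uB nuB]] := next_crossing uc xc yc xB yB.
have [w [wc wB nwB]] : exists u, [/\ u \in c, u \notin B & ~~ (next c u \notin B)].
  apply: (next_crossing (P := [pred z | z \notin B]) uc yc xc) => //=.
  by rewrite negbK.
rewrite negbK in nwB.
have [E1 E2] : u = next c w /\ next c u = w.
  apply: uniq_edge; rewrite ?mem_next //; first exact: next_cycle.
  by rewrite adj_sym; apply: next_cycle.
have [z zc zuw] : exists2 z, z \in c & z \notin [:: u; w].
  by apply/allPn/negP => /allP/(uniq_leq_size uc); rewrite leqNgt c3.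
have uuw : u \in [:: u; w] := mem_head _ _.
have [t [_ tuw]] := next_crossing (P := [in [:: u; w]]) uc uc' zc uuw zuw.
rewrite /= !inE in tuw *; case/orP: tuw => /eqP ->.
  by rewrite E2 eqxx orbT.
by rewrite -E1 eqxx.
Qed.

End OneSide.

(** * Rooted trees *)

Section RootedTree.
Variables (V : finType) (T : sgraph V) (r : V).

Lemma forest_bridge x y : forest T -> T x y ->
  ~~ connect (fun u w => T u w && ((u, w) != (x, y)) && ((u, w) != (y, x))) x y.
Proof.
move=> noC xy; apply/connectP => -[q0 pq0 ly]; case/shortenP: pq0 ly => q pq uq _ ly.
have Tq : path T x q by apply: sub_path pq => u w /andP[/andP[]].
case: q => [|z [|t q]] in pq uq ly Tq *.
- by rewrite /= in ly; rewrite ly adj_irr in xy.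
- by move: pq; rewrite /= in ly *; rewrite -ly eqxx !andbF.
have /negP[] := noC (x :: z :: t :: q).
apply/and3P; split=> //.
by rewrite /cycle rcons_path Tq -ly adj_sym.
Qed.

(** The depth is the distance to r, and the parent of x is a neighbour of x that
    is closer to r. An edge xy that does not join a vertex to its parent
    cannot exist: it would be a bridge, like all edges of a forest, while its
    ends are connected to r by chains of parents, which avoid it. *)
Lemma tree_parent : tree T -> exists (parent : V -> V) (depth : V -> nat),
  [/\ parent r = r,
      forall x, x != r -> T x (parent x) /\ depth (parent x) < depth x
    & forall x y, T x y -> y = parent x \/ x = parent y].
Proof.
case=> _ conT noC.
pose walk x n := `[< exists2 q, path T x q & last x q = r /\ size q = n >].
have walkE x : exists n, walk x n.
  have /connectP[q xq lq] := conT x r.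
  by exists (size q); apply/asboolP; exists q.
pose depth x := ex_minn (walkE x).
have descend x : x != r -> exists y, T x y && (depth y < depth x).
  move=> xr; rewrite {2}/depth; case: ex_minnP => n /asboolP[[|y q]] /=.
    by move=> _ [/eqP]; rewrite (negPf xr).
  case/andP=> xy yq [lq <-] _; exists y; rewrite xy /= ltnS /depth.
  by case: ex_minnP => m _; apply; apply/asboolP; exists q.
pose parent x :=
  if x == r then r else odflt r [pick y | T x y && (depth y < depth x)].
have pr : parent r = r by rewrite /parent eqxx.
have pP x : x != r -> T x (parent x) /\ depth (parent x) < depth x.
  move=> xr; rewrite /parent (negPf xr); case: pickP => [y /andP // | no].
  by have [y] := descend x xr; rewrite no.
exists parent, depth; split=> // x y xy.
have [->|/eqP yp] := y =P parent x; [by left | right; apply/eqP].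
apply/negPn/negP => xp; have := forest_bridge noC xy.
set e := (fun u w => _); have e_sym : connect_sym e.
  apply: sym_connect_sym => u w; rewrite /e adj_sym !xpair_eqE.
  by rewrite -!andbA; congr (_ && _); rewrite andbC ![(w == _) && _]andbC.
have to_root u : connect e u r.
  have [n] := ubnP (depth u); elim: n u => // n IH u un.
  have [-> // | ur] := eqVneq u r.
  have [Tu du] := pP u ur; apply: connect_trans (IH (parent u) _); last by lia.
  apply: connect1; rewrite /e Tu /= !xpair_eqE !negb_and.
  have [-> | //] := eqVneq u x; first rewrite eq_sym yp /=.
    by have [xy'|//] := eqVneq x y; rewrite xy' adj_irr in xy.
  by have [->|] := eqVneq u y; rewrite ?(eq_sym (parent y)) ?xp.
by case/negP; apply: connect_trans (to_root x) _; rewrite e_sym.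
Qed.

End RootedTree.

Section Descendants.
Variables (V : finType) (T : sgraph V) (r : V).
Variables (parent : V -> V) (depth : V -> nat).
Hypothesis parent_root : parent r = r.
Hypothesis parent_up :
  forall x, x != r -> T x (parent x) /\ depth (parent x) < depth x.
Hypothesis edge_parent : forall x y, T x y -> y = parent x \/ x = parent y.

Definition subtree v := [set x | fconnect parent x v].

Lemma subtree_refl v : v \in subtree v.
Proof. by rewrite inE. Qed.

Lemma subtree_trans u v x :
  x \in subtree u -> u \in subtree v -> x \in subtree v.
Proof. by rewrite !inE; apply: connect_trans. Qed.

Lemma subtree_step v x : parent x \in subtree v -> x \in subtree v.
Proof. by rewrite !inE; apply: connect_trans; exact: fconnect1. Qed.

Lemma subtree_ind v (P : V -> Prop) : P v ->
  (forall x, x != v -> parent x \in subtree v -> P (parent x) -> P x) ->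
  forall x, x \in subtree v -> P x.
Proof.
move=> Pv IH x; rewrite inE => /connectP[q].
elim: q x => [|y q IHq] x /=; first by move=> _ <-.
case/andP=> /eqP <- pq lq; have [-> // | xv] := eqVneq x v.
apply: IH => //; last exact: IHq.
by rewrite inE; apply/connectP; exists q.
Qed.

Lemma subtree_parent v x : x \in subtree v -> x != v -> parent x \in subtree v.
Proof. by move: x; apply: subtree_ind => [|x _ pv _ _ //]; rewrite eqxx. Qed.

Lemma subtree_root x : x \in subtree r.
Proof.
have [n] := ubnP (depth x); elim: n x => // n IH x xn.
have [-> | xr] := eqVneq x r; first exact: subtree_refl.
by have [_ dx] := parent_up xr; apply/subtree_step/IH; lia.
Qed.

Lemma root_subtree v : r \in subtree v -> v = r.
Proof.
rewrite inE => /connectP[q]; elim: q => [_ -> //|y q IH] /=.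
by rewrite parent_root => /andP[/eqP <-].
Qed.

Lemma subtree_neq_root v x : v != r -> x \in subtree v -> x != r.
Proof.
move=> vr xv; apply: contraNneq vr => xr.
by apply/eqP/root_subtree; rewrite -xr.
Qed.

Lemma subtree_child v x : x \in subtree v -> x != v ->
  exists w, [/\ parent w = v, w != r & x \in subtree w].
Proof.
move: x; apply: subtree_ind => [|x xv pv IH _]; first by rewrite eqxx.
have xr : x != r.
  apply: contraNneq xv => xr; rewrite xr parent_root in pv *.
  by rewrite (root_subtree pv).
have [pxv | /IH[w [pw wr xw]]] := eqVneq (parent x) v.
  by exists x; split=> //; exact: subtree_refl.
by exists w; split=> //; apply: subtree_step.
Qed.

Lemma child_depth w : w != r -> depth (parent w) < depth w.
Proof. by case/parent_up. Qed.

Lemma subtree_exit v x y : T x y -> x \in subtree v -> y \notin subtree v ->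
  x = v /\ y = parent v.
Proof.
move=> xy xv yv; case: (edge_parent xy) => [yp | xp]; last first.
  by rewrite (subtree_step (v := v)) -?xp in yv.
have [<- // | nxv] := eqVneq x v.
by rewrite yp (subtree_parent xv nxv) in yv.
Qed.

Lemma leaf_unique x y z : leaf T x -> T x y -> T x z -> y = z.
Proof.
rewrite /leaf => /cards1P[w E] xy xz.
have only u : T x u -> u = w by move=> xu; apply/finset.set1P; rewrite -E inE.
by rewrite (only y xy) (only z xz).
Qed.

Lemma leaf_subtree x y : leaf T x -> x != r -> y \in subtree x -> y = x.
Proof.
move=> lx xr yx; apply/eqP; apply: contraT => nyx.
have [w [pw wr _]] := subtree_child yx nyx.
have [Tx dx] := parent_up xr; have [Tw dw] := parent_up wr.
rewrite pw adj_sym in Tw dw; have E := leaf_unique lx Tx Tw.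
by rewrite E in dx; lia.
Qed.

(** When the root is a leaf, all other vertices descend from its neighbour. *)
Lemma leaf_root_child x y : leaf T r -> x != r -> y != r ->
  exists w, [/\ w != r, parent w = r, x \in subtree w & y \in subtree w].
Proof.
move=> lr xr yr; have [w [pw wr xw]] := subtree_child (subtree_root x) xr.
have [w' [pw' wr' yw]] := subtree_child (subtree_root y) yr.
have [Tw _] := parent_up wr; have [Tw' _] := parent_up wr'.
rewrite pw adj_sym in Tw; rewrite pw' adj_sym in Tw'.
by exists w; split=> //; rewrite (leaf_unique lr Tw Tw').
Qed.

Lemma connect_up (G : sgraph V) (D : {set V}) x v :
  (forall u w, T u w -> G u w) -> x \in subtree v -> v != r ->
  (forall u, x \in subtree u -> u \in subtree v -> u \in D) ->
  connect (inside G D) x v.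
Proof.
move=> TG xv vr; move: x xv; apply: subtree_ind => [|x nxv pv IH] inD //.
have xv := subtree_step pv; apply: connect_trans (IH _); last first.
  by move=> u pu uv; apply: inD => //; apply: subtree_step.
have [xr _] := parent_up (subtree_neq_root vr xv).
apply: connect1; rewrite /inside !inD ?subtree_refl ?TG //.
by rewrite inE fconnect1.
Qed.

End Descendants.

(** * Positions along a cycle *)

Section CyclicOrder.
Variables (V : finType) (r : V) (c' : seq V).
Local Notation c := (r :: c').
Hypothesis uc : uniq c.

Definition pos_in x := index x c.

Lemma pos_in_inj x y : x \in c -> pos_in x = pos_in y -> x = y.
Proof.
move=> xc E; rewrite -(nth_index r xc) -/(pos_in x) E nth_index //.
by rewrite -index_mem -/(pos_in y) -E index_mem.
Qed.

Lemma pos_in_eq0 x : (pos_in x == 0) = (x == r).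
Proof. by rewrite /pos_in /= (eq_sym x); case: (r == x). Qed.

Lemma pos_in_next x y : x \in c -> y = next c x ->
  y \in c /\ (pos_in y = (pos_in x).+1 \/
    y = r /\ forall z, z \in c -> pos_in z <= pos_in x).
Proof.
move=> xc ->; split; first by rewrite mem_next.
rewrite next_nth xc; have := xc; rewrite -index_mem -/(pos_in x) /= ltnS leq_eqVlt.
case/predU1P=> [E | lt].
  right; rewrite -/(pos_in x) E nth_default //; split=> // z.
  by rewrite -index_mem /= ltnS.
by left; rewrite -[nth _ _ _]/(nth r c (pos_in x).+1) /pos_in index_uniq.
Qed.

Lemma cycle_edge_next x y : cycle_edge c x y ->
  [/\ x \in c, y \in c & y = next c x \/ x = next c y].
Proof.
case/andP=> xc /orP[] /eqP ->.
  by split=> //; [rewrite mem_next | left].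
by split=> //; [rewrite mem_prev | right; rewrite next_prev].
Qed.

Lemma slice_connect (G : sgraph V) x y : (forall u w, cycle_edge c u w -> G u w) ->
  x \in c -> y \in c -> pos_in x <= pos_in y ->
  connect (inside G [set u in c | pos_in x <= pos_in u <= pos_in y]) x y.
Proof.
move=> cG xc; have [n] := ubnP (pos_in y); elim: n y => // n IH y yn yc.
rewrite leq_eqVlt => /predU1P[/(pos_in_inj xc) -> // | xy].
set z := prev c y; have zc : z \in c by rewrite mem_prev.
have zy : y = next c z by rewrite next_prev.
have [_ [yz | [yr _]]] := pos_in_next zc zy; last first.
  by move: xy; rewrite yr /pos_in index_head.
apply: connect_trans (_ : connect _ x z) _.
  have := IH z; rewrite yz in yn xy; move=> /(_ _ zc xy).
  have zn : pos_in z < n by lia.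
  move=> /(_ zn); apply: inside_connectS; apply/fintype.subsetP => u.
  by rewrite !inE => /andP[-> /andP[-> uz]] /=; lia.
apply: connect1; rewrite /inside !inE cG ?andbT; last first.
  by rewrite /cycle_edge zc zy eqxx.
move: zc yc; rewrite !inE => -> -> /=; lia.
Qed.

End CyclicOrder.

(** * Planarity makes the leaves of a subtree consecutive *)

Section Halin.
Variables (R : realType) (V : finType) (G T : sgraph V).
Variables (r : V) (c' : seq V) (parent : V -> V) (depth : V -> nat).
Local Notation c := (r :: c').
Local Notation pos := (pos_in r c').
Local Notation subtree := (subtree parent).
Hypothesis planarG : planar R G.
Hypothesis uc : uniq c.
Hypothesis leafT : forall x, (x \in c) = leaf T x.
Hypothesis GE : forall x y, G x y = T x y || cycle_edge c x y.
Hypothesis noC : forest T.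
Hypothesis parent_root : parent r = r.
Hypothesis parent_up :
  forall x, x != r -> T x (parent x) /\ depth (parent x) < depth x.
Hypothesis edge_parent : forall x y, T x y -> y = parent x \/ x = parent y.

Let TG x y : T x y -> G x y. Proof. by rewrite GE => ->. Qed.
Let CG x y : cycle_edge c x y -> G x y. Proof. by rewrite GE orbC => ->. Qed.

(** Otherwise, with w the neighbour of the root r, the graph contains nine paths
    joining x, z and w to r, y and v. The leaves r, x, y, z are in this order on
    the outer cycle, four sections of which join x and z to r and y. In the
    tree, x and z are joined to v below v; y, r and v are joined to w, the first
    two outside the subtree of v. *)
Lemma leaves_contiguous v x y z : v != r -> x \in c -> y \in c -> z \in c ->
  x \in subtree v -> z \in subtree v -> pos x < pos y < pos z -> y \in subtree v.
Proof.
move=> vr xc yc zc xv zv /andP[xy yz]; apply: contraT => yv.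
have pr0 : pos r = 0 by rewrite /pos_in index_head.
have xr := subtree_neq_root parent_root vr xv.
have zr := subtree_neq_root parent_root vr zv.
have x0 : 0 < pos x by rewrite lt0n pos_in_eq0.
have yr : y != r by rewrite -(pos_in_eq0 r c'); lia.
have leaf_only u w : u \in c -> u != r -> w \in subtree u -> w = u.
  by rewrite leafT; apply: leaf_subtree parent_root parent_up _ _.
have nonleaf u w : u != r -> w \in subtree u -> w != u -> u \notin c.
  by move=> ur wu; apply: contra => uc'; rewrite (leaf_only u w).
have vc : v \notin c.
  have [xv' | xv'] := eqVneq x v; last exact: nonleaf xv xv'.
  apply: nonleaf zv _ => //; apply: contraTneq yz => zv'.
  by rewrite -leqNgt zv' -xv' ltnW.
have lr : leaf T r by rewrite -leafT mem_head.
have [w [wr pw vw yw]] := leaf_root_child parent_root parent_up lr vr yr.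
have wv : w \notin subtree v.
  apply/negP => wv; case/negP: yv; exact: subtree_trans yw wv.
have wc : w \notin c.
  apply: nonleaf vw _ => //; apply: contraNneq wv => <-.
  exact: subtree_refl.
have rc : r \in c by rewrite mem_head.
pose a s := match s with One => x | Two => z | Three => w end.
pose b t := match t with One => r | Two => y | Three => v end.
pose slice u u' := [set t in c | pos u <= pos t <= pos u'].
pose late := [set t in c | pos z <= pos t].
pose inner := [set t | t \notin c].
pose below := [set t in inner | t \in subtree v].
pose beside := [set t in inner | t \notin subtree v].
pose D s t := match s, t with
  | One, One => slice r x
  | One, Two => slice x y
  | One, Three => x |: below
  | Two, One => r |: late
  | Two, Two => slice y z
  | Two, Three => z |: below
  | Three, One => [set w; r]
  | Three, Two => y |: beside
  | Three, Three => inner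
  end.
have inE' t : (t \in inner) = (t \notin c) by rewrite inE.
have belowE t : (t \in below) = (t \notin c) && (t \in subtree v).
  by rewrite inE inE'.
have besideE t : (t \in beside) = (t \notin c) && (t \notin subtree v).
  by rewrite inE inE'.
have lateE t : (t \in late) = (t \in c) && (pos z <= pos t) by rewrite inE.
have sliceE t q q' :
    (t \in slice q q') = (t \in c) && (pos q <= pos t <= pos q').
  by rewrite inE.
exfalso; apply: (@planar_no_K33 R V G a b D planarG).
  have up u : u \in c -> u != r -> u \in subtree v ->
    connect (inside G (u |: below)) u v.
    move=> uc' ur uv.
    apply: (connect_up parent_root parent_up TG uv vr) => t ut tv.
    have [->|tu] := eqVneq t u; first exact: setU11.
    apply/setU1r; rewrite belowE tv andbT.
    apply: (nonleaf _ _ (subtree_neq_root parent_root vr tv) ut).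
    by rewrite eq_sym.
  have slice_l u u' : u \in c -> pos u <= pos u' -> u \in slice u u'.
    by move=> uc' uu'; rewrite sliceE uc' leqnn.
  have slice_r u u' : u' \in c -> pos u <= pos u' -> u' \in slice u u'.
    by move=> uc' uu'; rewrite sliceE uc' leqnn andbT.
  have symc A u u' : connect (inside G A) u u' -> connect (inside G A) u' u.
    by rewrite sym_connect_sym //; exact: inside_sym.
  have rx : pos r <= pos x by rewrite pr0.
  case=> -[]; rewrite /a /b /D; split.
  - exact: slice_r.
  - exact: slice_l.
  - by apply/symc/slice_connect.
  - by apply: slice_l => //; exact: ltnW.
  - by apply: slice_r => //; exact: ltnW.
  - by apply: slice_connect => //; exact: ltnW.
  - exact: setU11.
  - by apply: setU1r; rewrite belowE vc subtree_refl.
  - exact: up.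
  - by apply: setU1r; rewrite lateE zc leqnn.
  - exact: setU11.
  (* From z to the last leaf of the cycle, then back to its first one, r. *)
  - have ec : prev c r \in c by rewrite mem_prev.
    have er : r = next c (prev c r) by rewrite next_prev.
    have [_ [|[_ last_e]]] := pos_in_next uc ec er; first by rewrite pr0.
    apply: connect_trans (_ : connect _ z (prev c r)) _.
      apply: inside_connectS (slice_connect uc CG zc ec (last_e z zc)).
      by apply/fintype.subsetP => u; rewrite inE => /and3P[uc' zu _];
        apply: setU1r; rewrite lateE uc' zu.
    apply: connect1; rewrite /inside setU11 setU1r; last by rewrite lateE ec last_e.
    by apply: CG; rewrite /cycle_edge ec -er eqxx.
  - by apply: slice_r => //; exact: ltnW.
  - by apply: slice_l => //; exact: ltnW.
  - by apply/symc/slice_connect => //; exact: ltnW.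
  - exact: setU11.
  - by apply: setU1r; rewrite belowE vc subtree_refl.
  - exact: up.
  - exact: finset.set21.
  - exact: finset.set22.
  - apply: connect1; rewrite /inside finset.set21 finset.set22 /=; apply: TG.
    by have [] := parent_up wr; rewrite pw.
  - by apply: setU1r; rewrite besideE wc wv.
  - exact: setU11.
  - apply: symc; apply: (connect_up parent_root parent_up TG yw wr) => t yt tw.
    have [->|ty] := eqVneq t y; first exact: setU11.
    apply/setU1r; rewrite besideE; apply/andP; split; last first.
      by apply: contra yv; apply: subtree_trans.
    apply: (nonleaf _ _ (subtree_neq_root parent_root wr tw) yt).
    by rewrite eq_sym.
  - by rewrite inE'.
  - by rewrite inE'.
  - apply: symc; apply: (connect_up parent_root parent_up TG vw wr) => t vt tw.
    rewrite inE'.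
    have [->|tv] := eqVneq t v; first by [].
    apply: (nonleaf _ _ (subtree_neq_root parent_root wr tw) vt).
    by rewrite eq_sym.
(* A leaf is located by its position, any other vertex by its being below v. *)
move=> s s' t t' ss' tt'; apply/pred0P => u /=; apply/negbTE/negP => /andP[].
have [uc' | nuc] := boolP (u \in c).
  have eqE q : q \in c -> (u == q) = (pos u == pos q).
    by move=> qc; apply/eqP/eqP => [-> // | /(pos_in_inj uc')].
  have uw : (u == w) = false by apply: contraNF wc => /eqP <-.
  have [ur [ux [uy uz]]] := (eqE r rc, (eqE x xc, (eqE y yc, eqE z zc))).
  have memE := (in_set2, in_setU1, sliceE, lateE, belowE, besideE, inE').
  case: s s' t t' ss' tt' => -[] [] [] // _ _; rewrite /D !memE;
    rewrite uc' ?uw ?ur ?ux ?uy ?uz ?pr0 /=; clear -xy yz x0; lia.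
have uwv : u == w -> u \notin subtree v by move/eqP ->.
have neqE q : q \in c -> (u == q) = false.
  by move=> qc; apply: contraNF nuc => /eqP ->.
have memE := (in_set2, in_setU1, sliceE, lateE, belowE, besideE, inE').
case: s s' t t' ss' tt' => -[] [] [] // _ _; rewrite /D !memE;
  rewrite (negPf nuc) ?(neqE r rc, neqE x xc, neqE y yc, neqE z zc) ?orbF //=;
  by case: (u == w) uwv => [/(_ isT)/negPf ->|_]; case: (u \in subtree v).
Qed.

Lemma subtree_cycle_exit v x y :
  v != r -> x \in subtree v -> y \notin subtree v -> cycle_edge c x y ->
  (forall z, z \in c -> z \in subtree v -> pos x <= pos z) /\ y = prev c x \/
  (forall z, z \in c -> z \in subtree v -> pos z <= pos x) /\ y = next c x.
Proof.
move=> vr xv yv /(cycle_edge_next uc)[xc yc [yx | xy]]; [right | left].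
  split=> // z zc zv; case: (pos_in_next uc xc yx) => _ [yx1 | [_ //]]; last exact.
  have zy : pos z != pos y by apply: contraNneq yv => /(pos_in_inj zc) <-.
  rewrite leqNgt; apply/negP => xz; case/negP: yv.
  by apply: leaves_contiguous vr xc yc zc xv zv _; rewrite yx1 in zy *; lia.
split; last by rewrite xy prev_next.
move=> z zc zv; case: (pos_in_next uc yc xy) => _ [xy1 | [xr _]]; last first.
  by have := subtree_neq_root parent_root vr xv; rewrite xr eqxx.
have zy : pos z != pos y by apply: contraNneq yv => /(pos_in_inj zc) <-.
rewrite leqNgt; apply/negP => zx; case/negP: yv.
by apply: leaves_contiguous vr zc yc xc zv xv _; rewrite xy1 in zx *; lia.
Qed.

(** * Greedy packing *)

Definition acyclic_on (A : {set V}) :=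
  forall cy, is_cycle G cy -> ~ {subset cy <= A}.

(** A cycle below v that avoids v has leaves on it, since T has no cycle. Let x be
    the last of them, and w the child of v above x. The edges leaving the
    subtree of w are its tree edge, which leads to v, the edge after its last
    leaf, which leads to r or to a leaf after x, and the edge before its first
    leaf. Only the last one can join two vertices of the cycle, so the cycle
    stays below w. *)
Lemma acyclic_below v (A : {set V}) :
  (forall w, w != r -> parent w = v -> acyclic_on (subtree w :&: A)) ->
  acyclic_on ((subtree v :&: A) :\ v).
Proof.
move=> children cy cyG cyA.
have cyP x : x \in cy -> [/\ x != v, x \in subtree v & x \in A].
  by move=> /cyA; rewrite finset.in_setD1 finset.in_setI => /and3P[].
have [/hasP[x0 x0cy x0c] | /hasPn noleaf] := boolP (has [in c] cy); last first.
  apply/negP: (noC cy); rewrite negbK; case/and3P: cyG => cy3 cyG ucy.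
  apply/and3P; split=> //; apply: (@sub_in_cycle _ (mem cy)) cyG; last exact/allP.
  move=> x y xcy ycy; rewrite GE => /orP[// | /andP[xc]].
  by have := noleaf x xcy; rewrite /= xc.
have [x /andP[xcy xc] xmax] : exists2 x, (x \in cy) && (x \in c)
    & forall y, (y \in cy) && (y \in c) -> pos y <= pos x.
  case: (@arg_maxnP _ x0 (fun x => (x \in cy) && (x \in c)) pos).
    by rewrite x0cy x0c.
  by move=> x hx xm; exists x.
have [xv xsub _] := cyP x xcy.
have [w [pw wr xw]] := subtree_child parent_root xsub xv.
have rcy : r \notin cy.
  apply/negP => /cyP[rv rsub _].
  by rewrite (root_subtree parent_root rsub) eqxx in rv.
suff [in_w | /(_ x xcy)] :
    {subset cy <= subtree w} \/ {in cy, forall x, x \notin subtree w}.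
- apply: (children w wr pw cy cyG) => y ycy; rewrite finset.in_setI in_w //.
  by have [] := cyP y ycy.
- by rewrite xw.
have exit y z : y \in cy -> z \in cy -> y \in subtree w -> z \notin subtree w ->
    G y z -> (forall t, t \in c -> t \in subtree w -> pos y <= pos t)
      /\ z = prev c y /\ y \in c.
  move=> ycy zcy yw zw; rewrite GE.
  move=> /orP[/(subtree_exit edge_parent)/(_ yw zw)[_ zE] | yz].
    by have [] := cyP z zcy; rewrite zE pw eqxx.
  have [yc zc _] := cycle_edge_next uc yz.
  have [[ymin zE] // | [ymax zE]] := subtree_cycle_exit wr yw zw yz.
  have [] := pos_in_next uc yc zE => _ [zy | [zr _]]; last first.
    by rewrite zr (negPf rcy) in zcy.
  have := xmax z; rewrite zcy zc zy => /(_ isT) yx.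
  by have := leq_trans yx (ymax x xc xw); rewrite ltnn.
apply: (cycle_one_side cyG).
move=> y z y' z' ycy zcy y'cy z'cy yw zw y'w z'w yz y'z'.
have [ymin [zE yc]] := exit _ _ ycy zcy yw zw yz.
have [y'min [z'E y'c]] := exit _ _ y'cy z'cy y'w z'w y'z'.
have yy' : y = y'.
  by apply: (pos_in_inj yc); apply/eqP; rewrite eqn_leq ymin // y'min.
by rewrite zE z'E yy'.
Qed.

(** Take for l the first leaf below v, if there is one. After the deletion of v
    and l, the subtree of v is joined to the other vertices only by the edge
    after its last leaf. *)
Lemma acyclic_cut v (A S : {set V}) :
  acyclic_on ((subtree v :&: A) :\ v) -> acyclic_on ((A :\: subtree v) :\: S) ->
  exists l, acyclic_on (A :\: (v |: (l |: S))).
Proof.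
move=> inner outer.
pose first x := [/\ x \in c, x \in subtree v
  & forall z, z \in c -> z \in subtree v -> pos x <= pos z].
have [l lP] : exists l, forall x, first x -> x = l.
  have [[l [lc lv lmin]] | no] := pselect (exists l, first l); last first.
    by exists v => x fx; case: no; exists x.
  exists l => x [xc xv xmin]; apply: (pos_in_inj xc); apply/eqP.
  by rewrite eqn_leq xmin // lmin.
exists l => cy cyG cyA.
have cyP x : x \in cy -> [/\ x != v, x != l, x \notin S & x \in A].
  by move=> /cyA; rewrite finset.in_setD !in_setU1 !negb_or => /andP[/and3P[]].
suff [in_v | out_v] :
    {subset cy <= subtree v} \/ {in cy, forall x, x \notin subtree v}.
- apply: (inner cy cyG) => x xcy; rewrite finset.in_setD1 finset.in_setI in_v //.
  by have [-> _ _ ->] := cyP x xcy.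
- apply: (outer cy cyG) => x xcy; rewrite !finset.in_setD out_v //.
  by have [_ _ -> ->] := cyP x xcy.
have [vr | vr] := eqVneq v r.
  by left=> x _; rewrite vr; exact: subtree_root parent_up x.
have exit y z : y \in cy -> y \in subtree v -> z \notin subtree v -> G y z ->
    (forall t, t \in c -> t \in subtree v -> pos t <= pos y)
      /\ z = next c y /\ y \in c.
  move=> ycy yv zv; rewrite GE.
  move=> /orP[/(subtree_exit edge_parent)/(_ yv zv)[yE _] | yz].
    by have [] := cyP y ycy; rewrite yE eqxx.
  have [yc _ _] := cycle_edge_next uc yz.
  have [[ymin _] | [ymax zE] //] := subtree_cycle_exit vr yv zv yz.
  by have [_] := cyP y ycy; rewrite (lP y) ?eqxx.
apply: (cycle_one_side cyG) => y z y' z' ycy _ y'cy _ yv zv y'v z'v yz y'z'.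
have [ymax [zE yc]] := exit _ _ ycy yv zv yz.
have [y'max [z'E y'c]] := exit _ _ y'cy y'v z'v y'z'.
have yy' : y = y'.
  by apply: (pos_in_inj yc); apply/eqP; rewrite eqn_leq y'max // ymax.
by rewrite zE z'E yy'.
Qed.

(** As long as A carries a cycle, a cycle below a deepest possible v is put into
    P, the two vertices v and l into S, and the subtree of v is discarded. *)
Lemma packing_transversal (A : {set V}) :
  exists (S : {set V}) (P : {set {set V}}),
  [/\ acyclic_on (A :\: S), cycle_packing G P, (forall B, B \in P -> B \subset A)
    & #|S| <= 2 * #|P|].
Proof.
have [n] := ubnP #|A|; elim: n A => // n IH A An.
have [acA | cycA] := pselect (acyclic_on A).
  exists finset.set0, finset.set0; rewrite finset.setD0 !cards0; split=> //.
  - by split=> [|B]; [apply/finset.trivIsetP => B B' | ]; rewrite inE.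
  - by move=> B; rewrite inE.
pose bad v := `[< ~ acyclic_on (subtree v :&: A) >].
have bad_r : bad r.
  apply/asboolP; suff -> : subtree r :&: A = A by [].
  by apply/setP => x; rewrite finset.in_setI (subtree_root parent_up).
case: (arg_maxnP depth bad_r) => v /asboolP bad_v vmax.
have inner : acyclic_on ((subtree v :&: A) :\ v).
  apply: acyclic_below => w wr pw; apply: contrapT => bad_w.
  have wv : depth w <= depth v := vmax w (introT (asboolP _) bad_w).
  by have := child_depth parent_up wr; rewrite pw ltnNge wv.
have [cy cyG cyA] : exists2 cy, is_cycle G cy & {subset cy <= subtree v :&: A}.
  by apply: contrapT => no; apply: bad_v => cy cyG cyA; apply: no; exists cy.
have [x xcy] : exists x, x \in cy.
  by case: cy cyG {cyA} => // x cy _; exists x; rewrite mem_head.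
have A'n : #|A :\: subtree v| < n.
  apply: (@leq_trans #|A|) => //; apply: proper_card; apply/fintype.properP.
  split; first exact: finset.subsetDl.
  have := cyA x xcy; rewrite finset.in_setI => /andP[xv xA].
  by exists x; rewrite // finset.in_setD xv.
have [S [P [acS [trP cycP] PA SP]]] := IH _ A'n.
have [l acl] := acyclic_cut inner acS.
pose Z := [set x in cy].
have disZ B : B \in P -> [disjoint Z & B].
  move=> /PA/fintype.subsetP BA; apply/pred0P => y /=.
  apply/negbTE/negP => /andP[yZ yB].
  have := BA y yB; have := cyA y; rewrite inE in yZ.
  by move=> /(_ yZ); rewrite finset.in_setI finset.in_setD => /andP[->].
have ZP : Z \notin P.
  by apply/negP => /disZ/pred0P/(_ x); rewrite /= inE xcy.
exists (v |: (l |: S)), (Z |: P); split=> //.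
- split.
    apply/finset.trivIsetP => B B' /setU1P[-> | BP] /setU1P[-> | BP'] neq.
    + by rewrite eqxx in neq.
    + exact: disZ.
    + by rewrite disjoint_sym disZ.
    + exact: (finset.trivIsetP trP).
  by move=> B /setU1P[-> | /cycP //]; exists cy.
- move=> B /setU1P[-> | /PA BA]; last first.
    exact: fintype.subset_trans BA (finset.subsetDl _ _).
  apply/fintype.subsetP => y; rewrite inE => /cyA.
  by rewrite finset.in_setI => /andP[].
rewrite !cardsU1 ZP mulnDr addnA; apply: leq_add SP.
by case: (v \notin _); case: (l \notin _).
Qed.

End Halin.

Lemma acyclic_feedback (V : finType) (G : sgraph V) (S : {set V}) :
  acyclic_on G (~: S) -> feedback_vertex_set G S.
Proof.
move=> acS cy; apply/negP => /and3P[cy3 cyG ucy].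
apply: (acS (map val cy)).
  apply/and3P; split; first by rewrite size_map.
    by case: cy cyG {cy3 ucy} => //= x cy; rewrite -map_rcons; apply: homo_path.
  by rewrite map_inj_uniq //; exact: val_inj.
by move=> _ /mapP[x _ ->]; exact: valP.
Qed.

Theorem corollary1p8 (R : realType) (V : finType) (G : sgraph V)
  (hG : halin R G) : fvs G <= 2 * cp G.
Proof.
case: hG => planarG [T [[|r c'] [treeT [uc // _] leafT GE]]].
have [parent [depth [parent_root parent_up edge_parent]]] := tree_parent r treeT.
have [_ _ noC] := treeT.
have [S [P [acS packP _ SP]]] := packing_transversal planarG uc leafT GE noC
  parent_root parent_up edge_parent finset.setT.
apply: leq_trans (proj2 (fvsP G) S _) _.
  by apply: acyclic_feedback; rewrite -finset.setTD.
by apply: leq_trans SP _; rewrite leq_mul2l /= cp_max.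
Qed.
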